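(* Let $G$ be a simple Lie group (a real form, e.g. split, of a complex simple Lie group), $\mathfrak g=\mathrm{Lie}(G)$, and $(\cdot,\cdot)$ the Killing form on $\mathfrak g$. In a (sufficiently small, connected) neighborhood of the identity of $G$, all $\mathrm{Ad}_G$-invariant solutions $H$ of the equation $$\xi=\nabla H(e^\xi)$$ have the form $$H(e^\xi)=\tfrac12(\xi,\xi)+\mathrm{const}.$$
   Context: For a smooth function $f$ on (an open subset of) $G$, the $\mathfrak g$-valued gradient $\nabla f$ is defined by $(\nabla f(g),\eta)=\langle df(g),X_\eta\rangle$ for all $\eta\in\mathfrak g$, where $X_\eta$ is the left-invariant vector field on $G$ corresponding to $\eta$. $\mathrm{Ad}_G$-invariant means invariant under conjugation, $f(kgk^{-1})=f(g)$ (whenever both sides are defined). The neighborhood is the diffeomorphic image under $\exp$ of a neighborhood of $0\in\mathfrak g$. *)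

(* Defs.v *)
From HB Require Import structures.
From mathcomp Require Import all_boot all_order all_algebra.
From mathcomp Require Import complex.
From mathcomp Require Import all_classical all_reals all_analysis.

Set Implicit Arguments.
Unset Strict Implicit.
Unset Printing Implicit Defensive.

Import Order.TTheory GRing.Theory Num.Theory.
Import numFieldNormedType.Exports.

Local Open Scope classical_set_scope.
Local Open Scope ring_scope.

(* Meant for open [U]. In finite dimension this is the usual notion: a map is
   C^(k+1) iff it is differentiable and all its directional derivatives are
   C^k. *)
Fixpoint Ck (R : realType) (V W : normedModType R) (k : nat) (U : set V)
    (f : V -> W) : Prop :=
  match k with
  | 0 => forall x, U x -> {for x, continuous f}
  | k'.+1 => (forall x, U x -> differentiable f x) /\
             (forall v : V, Ck k' U (fun x => 'D_v f x))
  end.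

Definition smooth (R : realType) (V W : normedModType R) (U : set V)
    (f : V -> W) : Prop :=
  forall k, Ck k U f.

(* [chart_coord] is meaningful on [chart_dom] only, and its local inverse
   [chart_param] on [chart_im] only. *)
Record chart (R : realType) (n : nat) (G : Type) := Chart {
  chart_dom : set G;
  chart_coord : G -> 'rV[R]_n;
  chart_param : 'rV[R]_n -> G
}.

Definition chart_im (R : realType) (n : nat) (G : Type) (a : chart R n G) :
    set 'rV[R]_n :=
  chart_coord a @` chart_dom a.

Definition is_chart (R : realType) (n : nat) (G : topologicalType)
    (a : chart R n G) : Prop :=
  [/\ open (chart_dom a),
      open (chart_im a),
      (forall g, chart_dom a g -> chart_param a (chart_coord a g) = g),
      (forall g, chart_dom a g -> {for g, continuous (chart_coord a)}) &
      (forall x, chart_im a x -> {for x, continuous (chart_param a)})].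

HB.structure Definition TopologicalAndGroup :=
  {G of Group G & Topological G}.

(* Real Lie groups of dimension [n]: second countable Hausdorff smooth
   manifolds, given by an atlas, with smooth multiplication and inversion. *)
HB.mixin Record isLieGroup (R : realType) (n : nat) G
    of Group G & Topological G := {
  lie_atlas : set (chart R n G);
  lie_hausdorff : hausdorff_space G;
  lie_second_countable : @second_countable G;
  lie_atlas_chart : forall a, lie_atlas a -> is_chart a;
  lie_atlas_cover : forall g : G, exists2 a, lie_atlas a & chart_dom a g;
  lie_transition_smooth : forall a b, lie_atlas a -> lie_atlas b ->
    smooth (chart_coord a @` (chart_dom a `&` chart_dom b))
      (fun x => chart_coord b (chart_param a x));
  lie_mul_continuous : continuous (fun z : G * G => (z.1 * z.2)%g);
  lie_mul_smooth : forall a b c, lie_atlas a -> lie_atlas b -> lie_atlas c ->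
    smooth [set z : 'rV[R]_n * 'rV[R]_n | [/\ chart_im a z.1, chart_im b z.2 &
              chart_dom c (chart_param a z.1 * chart_param b z.2)%g]]
      (fun z => chart_coord c (chart_param a z.1 * chart_param b z.2)%g);
  lie_inv_continuous : continuous (fun g : G => (g^-1)%g);
  lie_inv_smooth : forall a b, lie_atlas a -> lie_atlas b ->
    smooth [set x | chart_im a x /\ chart_dom b ((chart_param a x)^-1)%g]
      (fun x => chart_coord b ((chart_param a x)^-1)%g)
}.

#[short(type="lieGroupType")]
HB.structure Definition LieGroup (R : realType) (n : nat) :=
  {G of isLieGroup R n G & Group G & Topological G}.

Definition smooth_on (R : realType) (n : nat) (G : lieGroupType R n)
    (W : normedModType R) (U : set G) (f : G -> W) : Prop :=
  forall a : chart R n G, lie_atlas a ->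
    smooth (chart_coord a @` (chart_dom a `&` U)) (fun x => f (chart_param a x)).

Definition smooth_into (R : realType) (n : nat) (G : lieGroupType R n)
    (W : normedModType R) (V : set W) (f : W -> G) : Prop :=
  (forall x, V x -> {for x, continuous f}) /\
  (forall a : chart R n G, lie_atlas a ->
     smooth (V `&` f @^-1` chart_dom a) (fun x => chart_coord a (f x))).

Definition diffeo_onto_open_image (R : realType) (n : nat)
    (G : lieGroupType R n) (V : set 'rV[R]_n) (f : 'rV[R]_n -> G) : Prop :=
  [/\ open (f @` V),
      smooth_into V f &
      exists2 l : G -> 'rV[R]_n,
        (forall x, V x -> l (f x) = x) & smooth_on (f @` V) l].

(* The tangent space at the identity is identified with 'rV[R]_n through such
   a chart [phi]; this is how 'rV[R]_n carries the Lie algebra of G below. *)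
Definition chart_at_identity (R : realType) (n : nat) (G : lieGroupType R n)
    (phi : chart R n G) : Prop :=
  lie_atlas phi /\ chart_dom phi 1%g.

(* <dF(g), X_eta>, where X_eta(g) = d(L_g)_1 eta is the left-invariant vector
   field of eta: by the chain rule it is d(F \o L_g)_1 eta. *)
Definition left_invariant_derive (R : realType) (n : nat)
    (G : lieGroupType R n) (phi : chart R n G) (W : normedModType R)
    (eta : 'rV[R]_n) (F : G -> W) (g : G) : W :=
  'D_eta (fun x => F (g * chart_param phi x)%g) (chart_coord phi 1%g).

(* [X_eta, X_zeta] at the identity; a tangent vector at the identity is read
   off by letting it act on the coordinate functions of [phi]. *)
Definition lie_bracket (R : realType) (n : nat) (G : lieGroupType R n)
    (phi : chart R n G) (eta zeta : 'rV[R]_n) : 'rV[R]_n :=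
  let X := left_invariant_derive phi (W := 'rV[R]_n) in
  X eta (X zeta (chart_coord phi)) 1%g - X zeta (X eta (chart_coord phi)) 1%g.

(* Acts on row vectors: zeta *m lie_ad phi eta = [eta, zeta]. The reversed order
   of composition does not matter under the trace in [killing]. *)
Definition lie_ad (R : realType) (n : nat) (G : lieGroupType R n)
    (phi : chart R n G) (eta : 'rV[R]_n) : 'M[R]_n :=
  lin1_mx (lie_bracket phi eta).

Definition killing (R : realType) (n : nat) (G : lieGroupType R n)
    (phi : chart R n G) (eta zeta : 'rV[R]_n) : R :=
  \tr (lie_ad phi eta *m lie_ad phi zeta).

(* Simplicity of the Lie algebra 'rV[F]_n with bracket [br]; a subspace is
   given as the row space of a square matrix. *)
Definition simple_lie_algebra (F : fieldType) (n : nat)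
    (br : 'rV[F]_n -> 'rV[F]_n -> 'rV[F]_n) : Prop :=
  (exists x y, br x y <> 0) /\
  (forall I : 'M[F]_n,
     (forall x y, (y <= I)%MS -> (br x y <= I)%MS) -> I = 0 \/ row_full I).

Definition complexified_bracket (R : realType) (n : nat)
    (br : 'rV[R]_n -> 'rV[R]_n -> 'rV[R]_n) (x y : 'rV[R[i]]_n) :
    'rV[R[i]]_n :=
  let re := map_mx (@complex.Re R) in
  let im := map_mx (@complex.Im R) in
  let u := br (re x) (re y) - br (im x) (im y) in
  let v := br (re x) (im y) + br (im x) (re y) in
  \row_j (u ord0 j +i* v ord0 j)%C.

Definition simple_lie_group (R : realType) (n : nat) (G : lieGroupType R n)
    (phi : chart R n G) : Prop :=
  simple_lie_algebra (lie_bracket phi).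

(* Real form is understood on Lie algebras: the complexification of Lie(G) is
   a simple complex Lie algebra. This excludes the complex simple Lie groups
   regarded as real ones. *)
Definition real_form_of_complex_simple (R : realType) (n : nat)
    (G : lieGroupType R n) (phi : chart R n G) : Prop :=
  simple_lie_algebra (complexified_bracket (lie_bracket phi)).

(* Every Lie group has exactly one such map: t |-> expG (t xi) is the
   one-parameter subgroup with velocity xi at t = 0. *)
Definition is_exponential (R : realType) (n : nat) (G : lieGroupType R n)
    (phi : chart R n G) (expG : 'rV[R]_n -> G) : Prop :=
  forall xi : 'rV[R]_n,
    [/\ continuous (fun t : R => expG (t *: xi)),
        (forall s t : R,
           expG ((s + t) *: xi) = (expG (s *: xi) * expG (t *: xi))%g) &
        is_derive (0 : R) 1 (fun t : R => chart_coord phi (expG (t *: xi))) xi].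

Definition Ad_invariant_on (R : realType) (n : nat) (G : lieGroupType R n)
    (U : set G) (f : G -> R) : Prop :=
  forall k g : G, U g -> U (k * g * k^-1)%g -> f (k * g * k^-1)%g = f g.

Definition is_gradient_on (R : realType) (n : nat) (G : lieGroupType R n)
    (phi : chart R n G) (U : set G) (f : G -> R) (grad : G -> 'rV[R]_n) : Prop :=
  forall g, U g -> forall eta : 'rV[R]_n,
    killing phi (grad g) eta = left_invariant_derive phi eta f g.

(* Main.v *)
Require Import Defs.
From HB Require Import structures.
From mathcomp Require Import all_boot all_order all_algebra.
From mathcomp Require Import complex ring.
From mathcomp Require Import all_classical all_reals all_analysis.

Set Implicit Arguments.
Unset Strict Implicit.
Unset Printing Implicit Defensive.

Import Order.TTheory GRing.Theory Num.Theory.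
Import numFieldNormedType.Exports.

Local Open Scope classical_set_scope.
Local Open Scope ring_scope.

(** Left-trivialise: for [xi] in [V] the hypotheses say that the left-invariant
    derivative of [H] at [exp xi] along [eta] is [(xi, eta)]; in particular
    [(xi, .)] is linear. Since [exp (t xi + s zeta)] is the square of
    [exp ((t xi + s zeta) / 2)], the product rule and the invariance of [H]
    under conjugation by [exp (t xi / 2)] allow the perturbation [s zeta] to be
    moved into a single half. By iteration, for [t = 2^-k],
      [d/ds H (exp xi exp (- t xi) exp (t xi + s zeta))]  at  [s = 0]
    is independent of [k]. For [k = 0] it is [d/ds H (exp (xi + s zeta))], and it
    tends to [(xi, zeta)] as [k] grows. Hence [H (exp xi)] and [(xi, xi) / 2]
    have the same derivative on the connected open set [V]. *)

(** Chart expressions agree with the maps they describe only near a point, so differentiability has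
    to pass between germs: the first-order expansion of [f] at [a] also serves for [g]. *)
Lemma near_eq_differentiable (R : numFieldType) (V W : normedModType R)
    (f g : V -> W) (a : V) :
  (\near a, f a = g a) -> differentiable f a -> differentiable g a.
Proof.
move=> fg df; have [dfc dfo] := (diff_locallyP _ _).1 df.
have gE : g \o shift a = cst (g a) + 'd f a +o_ 0 id.
  apply/eqaddoP => e e0; move/eqaddoP : dfo => /(_ e e0).
  apply: filter_app; move: (fg); rewrite (near_shift 0)/=.
  apply: filterS => y /=; rewrite !fctE /= subr0 => ->.
  by rewrite (nbhs_singleton fg).
by apply/diff_locallyP; rewrite (diff_unique dfc gE).
Qed.

Lemma half_iter_cvg0 (R : realType) (E : normedModType R) (x : E) :
  (2^-1 ^+ k) *: x @[k --> \oo] --> (0 : E).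
Proof.
rewrite -(scale0r x); apply: cvgZr_tmp; apply: cvg_expr.
by rewrite ger0_norm// invf_lt1// ltr1n.
Qed.

(** * Differentiability of maps into a Lie group *)

Section group_differentiability.
Context (R : realType) (n : nat) (G : lieGroupType R n).
Implicit Types E W : normedModType R.

(** Continuity is a separate clause because coordinates mean something only on [chart_dom a]; it
    keeps [f y] in that domain for [y] near [x]. *)
Definition gdiff E (f : E -> G) (x : E) : Prop :=
  {for x, continuous f} /\
  (forall a : chart R n G, lie_atlas a -> chart_dom a (f x) ->
     differentiable (fun y => chart_coord a (f y)) x).

Lemma near_chart_dom E (f : E -> G) (x : E) (a : chart R n G) :
  {for x, continuous f} -> lie_atlas a -> chart_dom a (f x) ->
  \forall y \near x, chart_dom a (f y).
Proof.
move=> fx Aa afx; apply: fx; apply: open_nbhs_nbhs; split => //.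
by have [] := lie_atlas_chart _ Aa.
Qed.

Lemma chart_coordK (a : chart R n G) g : lie_atlas a -> chart_dom a g ->
  chart_param a (chart_coord a g) = g.
Proof. by move=> /(lie_atlas_chart _)[_ _ + _ _]; apply. Qed.

Lemma gdiff_cst E (g : G) (x : E) : gdiff (fun=> g) x.
Proof. by split=> [|a _ _]; [exact: cvg_cst|exact: differentiable_cst]. Qed.

Lemma gdiff_comp E E' (f : E -> E') (h : E' -> G) x :
  differentiable f x -> gdiff h (f x) -> gdiff (fun y => h (f y)) x.
Proof.
move=> df [hc hd]; split=> [|a Aa ax].
  apply: (@continuous_comp _ _ _ f h) => //; exact: differentiable_continuous.
exact: (differentiable_comp df (hd a Aa ax)).
Qed.

Lemma gdiff_mul E (f h : E -> G) x :
  gdiff f x -> gdiff h x -> gdiff (fun y => (f y * h y)%g) x.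
Proof.
move=> [fc fd] [hc hd]; split=> [|c Ac cx].
  apply: (@cvg_comp _ _ _ (fun y => (f y, h y)) (fun z : G * G => (z.1 * z.2)%g)
    _ (nbhs (f x, h x))); first exact: cvg_pair.
  exact: (@lie_mul_continuous _ _ G (f x, h x)).
have [a Aa afx] := lie_atlas_cover (f x).
have [b Ab bhx] := lie_atlas_cover (h x).
pose M := fun z : 'rV[R]_n * 'rV[R]_n =>
  chart_coord c (chart_param a z.1 * chart_param b z.2)%g.
apply: (@near_eq_differentiable _ _ _
    (M \o (fun y => (chart_coord a (f y), chart_coord b (h y))))).
  near=> y; rewrite /M /= !chart_coordK //; near: y; exact: near_chart_dom.
apply: differentiable_comp.
  by apply: differentiable_pair; [exact: fd|exact: hd].
(* Order [1] of smoothness contains the differentiability of multiplication read in charts. *)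
apply: (lie_mul_smooth _ _ _ Aa Ab Ac 1).1; split => /=.
- by exists (f x).
- by exists (h x).
- by rewrite !chart_coordK.
Unshelve. all: by end_near. Qed.

Lemma gdiff_param (a : chart R n G) x : lie_atlas a -> chart_im a x ->
  gdiff (chart_param a) x.
Proof.
move=> Aa [g ag <-]; split=> [|b Ab bg].
  by have [_ _ _ _] := lie_atlas_chart _ Aa; apply; exists g.
apply: (lie_transition_smooth _ _ Aa Ab 1).1; exists g => //; split => //.
by rewrite chart_coordK in bg.
Qed.

Lemma smooth_on_differentiable E W (U : set G) (h : G -> W) (f : E -> G) x :
  smooth_on U h -> gdiff f x -> U (f x) ->
  differentiable (fun y => h (f y)) x.
Proof.
move=> hs [fc fd] Ufx; have [a Aa afx] := lie_atlas_cover (f x).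
apply: (@near_eq_differentiable _ _ _
    ((fun z => h (chart_param a z)) \o (fun y => chart_coord a (f y)))).
  near=> y; rewrite /= chart_coordK //; near: y; exact: near_chart_dom.
apply: differentiable_comp; first exact: fd.
by apply: (hs a Aa 1).1; exists (f x).
Unshelve. all: by end_near. Qed.

End group_differentiability.

(** * The exponential map and its differentiability at every point *)

Section exponential.
Context (R : realType) (n : nat) (G : lieGroupType R n).
Variables (phi : chart R n G) (expG : 'rV[R]_n -> G).
Hypothesis hexp : is_exponential phi expG.

Lemma expD_scale (s t : R) x :
  expG ((s + t) *: x) = (expG (s *: x) * expG (t *: x))%g.
Proof. by have [_ + _] := hexp x; apply. Qed.

Lemma exp0 : expG 0 = 1%g.
Proof.
have := expD_scale 0 0 0; rewrite addr0 scale0r => h.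
by apply: (@mulgI _ (expG 0)); rewrite -h mulg1.
Qed.

Lemma exp_half x : expG x = (expG (2^-1 *: x) * expG (2^-1 *: x))%g.
Proof. by rewrite -expD_scale -[2^-1]div1r -splitr scale1r. Qed.

Lemma expN x : (expG (- x) * expG x = 1)%g.
Proof.
by rewrite -{2}[x]scale1r -scaleN1r -expD_scale addNr scale0r exp0.
Qed.

(** Some [2^-1 ^+ k *: x] lies in [V], and [k] squarings by [exp_half] carry differentiability from
    there to [x]. Points outside [V] matter later: [V] need not be star-shaped, so [t *: xi] may
    leave it. *)
Lemma gdiff_exp (V : set 'rV[R]_n) : open V -> V 0 -> smooth_into V expG ->
  forall x, gdiff expG x.
Proof.
move=> Vo V0 [Vc Vs].
have VP x : V x -> gdiff expG x.
  move=> Vx; split=> [|a Aa ax]; first exact: Vc.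
  by apply: (Vs a Aa 1).1; split.
move=> x.
have [k Vk] : exists k, V ((2^-1 ^+ k) *: x).
  have : \forall k \near \oo, V ((2^-1 ^+ k) *: x).
    by apply: (half_iter_cvg0 x); apply: open_nbhs_nbhs; split.
  by case=> k _ /(_ k (leqnn k)) ?; exists k.
elim: k x Vk => [|k IH] x; first by rewrite expr0 scale1r; exact: VP.
rewrite exprSr -scalerA => /IH dx.
rewrite (_ : expG = fun x => (expG (2^-1 *: x) * expG (2^-1 *: x))%g); last first.
  by apply/funext => y; exact: exp_half.
by apply: gdiff_mul; apply: gdiff_comp => //; exact: is_diff_scaler.
Qed.

End exponential.

(** * Calculus in normed spaces: finite sums, chain rule, partial derivatives *)

Lemma cvg_bigsum (R : numFieldType) (W : normedModType R) (T I : Type)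
    (F : set_system T) (FF : Filter F) (r : seq I)
    (f : I -> T -> W) (l : I -> W) :
  (forall i, f i @ F --> l i) ->
  (fun t => \sum_(i <- r) f i t) @ F --> \sum_(i <- r) l i.
Proof.
move=> fl; elim: r => [|i r IH].
  rewrite big_nil (_ : (fun _ => _) = cst 0); first exact: cvg_cst.
  by apply/funext => t; rewrite big_nil.
rewrite big_cons (_ : (fun _ => _) = (fun t => f i t + \sum_(j <- r) f j t)).
  exact: cvgD.
by apply/funext => t; rewrite big_cons.
Qed.

Lemma derive_comp (R : numFieldType) (U V W : normedModType R)
    (f : U -> V) (g : V -> W) x v :
  differentiable f x -> differentiable g (f x) ->
  'D_v (g \o f) x = 'd g (f x) ('D_v f x).
Proof.
move=> df dg; rewrite (deriveE _ df) (deriveE _ (differentiable_comp df dg)).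
by rewrite diff_comp.
Qed.

Lemma derive_pair (R : numFieldType) (U V W : normedModType R)
    (f : U -> V) (g : U -> W) x v :
  differentiable f x -> differentiable g x ->
  'D_v (fun y => (f y, g y)) x = ('D_v f x, 'D_v g x).
Proof.
move=> df dg; rewrite (deriveE _ df) (deriveE _ dg).
by rewrite (deriveE _ (differentiable_pair df dg)) diff_pair.
Qed.

Section partial.
Context (R : numFieldType) (E1 E2 W : normedModType R).
Implicit Types f : E1 * E2 -> W.

Lemma differentiable_fst (p : E1 * E2) : differentiable fst p.
Proof. by apply: linear_differentiable => q; exact: cvg_fst. Qed.

Lemma differentiable_snd (p : E1 * E2) : differentiable snd p.
Proof. by apply: linear_differentiable => q; exact: cvg_snd. Qed.

Lemma differentiable_pairr (a : E1) (b : E2) :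
  differentiable (fun y : E2 => (a, y)) b.
Proof. by apply: differentiable_pair; [exact: differentiable_cst|]. Qed.

Lemma differentiable_pairl (a : E1) (b : E2) :
  differentiable (fun x : E1 => (x, b)) a.
Proof. by apply: differentiable_pair; [|exact: differentiable_cst]. Qed.

Lemma diff_partialr f a b v : differentiable f (a, b) ->
  'd f (a, b) (0, v) = 'D_v (fun y => f (a, y)) b.
Proof.
move=> df; rewrite deriveE; last first.
  exact: (differentiable_comp (differentiable_pairr a b)).
rewrite (diff_comp (differentiable_pairr a b) df) /= diff_pair //.
by rewrite diff_cst diff_val.
Qed.

Lemma diff_partiall f a b v : differentiable f (a, b) ->
  'd f (a, b) (v, 0) = 'D_v (fun x => f (x, b)) a.
Proof.
move=> df; rewrite deriveE; last first.
  exact: (differentiable_comp (differentiable_pairl a b)).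
rewrite (diff_comp (differentiable_pairl a b) df) /= diff_pair //.
by rewrite diff_cst diff_val.
Qed.

End partial.

(** * Functions with vanishing directional derivatives *)

Lemma derive_zero_locally_constant (R : realType) (E : normedModType R)
    (f : E -> R) (V : set E) (x : E) :
  open V -> V x -> (forall y v, V y -> is_derive y v f 0) ->
  \forall y \near x, V y /\ f y = f x.
Proof.
move=> Vo Vx df.
have /nbhs_ballP[e e0 eV] : nbhs x V by exact: open_nbhs_nbhs.
apply/nbhs_ballP; exists e => // y xy; split; first exact: eV.
(* A ball is convex, so the segment from [x] to [y] stays in [V] and the mean value theorem applies
   along it. *)
have inV (t : R) : t \in `[0, 1]%R -> V (t *: (y - x) + x).
  rewrite in_itv/= => /andP[t0 t1]; apply: eV; move: xy.
  rewrite -ball_normE /= opprD addrCA subrr addr0 normrN normrZ ger0_norm//.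
  by rewrite distrC; apply: le_lt_trans; rewrite ler_piMl.
have dg (t : R) : t \in `[0, 1]%R ->
    is_derive t (1 : R) (fun s : R => f (s *: (y - x) + x)) 0.
  move=> /inV /df -/(_ (y - x)) [fd fE].
  have gE : (fun h : R => h^-1 *: (f ((h *: (1 : R) + t) *: (y - x) + x)
               - f (t *: (y - x) + x)))
      = (fun h => h^-1 *: (f (h *: (y - x) + (t *: (y - x) + x))
               - f (t *: (y - x) + x))).
    by apply/funext => h; rewrite scalerDl addrA -[h *: 1]/(h * 1) mulr1.
  by split; rewrite /derivable /derive /= gE.
have gc : {within `[0%R, 1%R], continuous (fun s : R => f (s *: (y - x) + x))}.
  by apply: derivable_within_continuous => t /dg[].
have dg' (t : R) : t \in `]0, 1[%R ->
    is_derive t (1 : R) (fun s : R => f (s *: (y - x) + x)) 0.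
  by move=> /subset_itv_oo_cc; exact: dg.
have [c _] := MVT_segment (ler01 : (0 : R) <= 1) dg' gc.
by rewrite scale1r subrK scale0r add0r mul0r => /eqP; rewrite subr_eq0 => /eqP.
Qed.

(** Local constancy makes the level set of [f] through [x] both relatively open and relatively
    closed in [V]. *)
Lemma derive_zero_constant (R : realType) (E : normedModType R)
    (f : E -> R) (V : set E) :
  open V -> connected V -> (forall y v, V y -> is_derive y v f 0) ->
  forall x y, V x -> V y -> f y = f x.
Proof.
move=> Vo Vc df x y Vx Vy.
have loc z := @derive_zero_locally_constant R E f V z Vo.
pose C := [set z | V z /\ f z = f x].
pose D := [set z | V z /\ f z <> f x].
have Co : open C.
  rewrite openE => z [Vz fz]; apply: filterS (loc z Vz df) => w [Vw fw].
  by split=> //; rewrite fw.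
have Do : open D.
  rewrite openE => z [Vz fz]; apply: filterS (loc z Vz df) => w [Vw fw].
  by split=> //; rewrite fw.
suff VC : C = V by move: Vy; rewrite -VC => -[].
apply: Vc; first by exists x; split.
- by exists C => //; apply/seteqP; split=> z /= [] //; move=> Vz; case.
- exists (~` D); first exact: open_closedC.
  apply/seteqP; split=> z /= [Vz h]; split => //; first by case.
  by apply: contrapT => fz; apply: h.
Qed.

(** * The derivative of an invariant function composed with the exponential map *)

Section radial_derivative.
Context (R : realType) (n : nat) (G : lieGroupType R n).
Variables (phi : chart R n G) (expG : 'rV[R]_n -> G).
Hypothesis hphi : chart_at_identity phi.
Hypothesis hexp : is_exponential phi expG.
Hypothesis gexp : forall x, gdiff expG x.
Variables (U : set G) (H : G -> R).
Hypothesis Uo : open U.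
Hypothesis Hs : smooth_on U H.
Hypothesis HAd : Ad_invariant_on U H.
Variable xi : 'rV[R]_n.
Hypothesis Uxi : U (expG xi).

(** The argument of [H] at the base point is [expG xi] for every [t]. At [t = 1] this is the
    derivative of [H] composed with [expG] at [xi]; as [t = 2^-1 ^+ k] tends to [0] it approaches
    the left-invariant derivative at [expG xi]. *)
Let psi (t : R) (zeta : 'rV[R]_n) : R :=
  'D_zeta (fun z => H (expG ((1 - t) *: xi) * expG z)%g) (t *: xi).

(** By [exp_half], the derivative is half the sum of the two partial derivatives of [P] at [(h, h)].
    The second one is [psi (t / 2) zeta] by [uh]; the first becomes it after conjugation by
    [expG h], which brings the last factor to the front. *)
Lemma psi_half t zeta : psi t zeta = psi (t / 2) zeta.
Proof.
pose u := expG ((1 - t) *: xi); pose h := (t / 2) *: xi.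
pose P (p : 'rV[R]_n * 'rV[R]_n) := H (u * expG p.1 * expG p.2)%g.
have uhh : (u * expG h * expG h)%g = expG xi.
  by rewrite -mulgA -!(expD_scale hexp) -splitr subrK scale1r.
have uh : (u * expG h)%g = expG ((1 - t / 2) *: xi).
  rewrite -(expD_scale hexp); congr (expG (_ *: _)).
  by rewrite [in 1 - t](splitr t) opprD addrA subrK.
have hu : (expG h * u)%g = expG ((1 - t / 2) *: xi).
  rewrite -(expD_scale hexp) addrC; congr (expG (_ *: _)).
  by rewrite [in 1 - t](splitr t) opprD addrA subrK.
have dP : differentiable P (h, h).
  apply: (smooth_on_differentiable Hs); last by rewrite /= uhh.
  apply: gdiff_mul; last exact: (gdiff_comp (@differentiable_snd _ _ _ _)).
  apply: gdiff_mul; first exact: gdiff_cst.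
  exact: (gdiff_comp (@differentiable_fst _ _ _ _)).
have d2 (z : 'rV[R]_n) :
    differentiable (fun y : 'rV[R]_n => 2^-1 *: y) z.
  by [].
have dd (z : 'rV[R]_n) :
    differentiable (fun y : 'rV[R]_n => (2^-1 *: y, 2^-1 *: y)) z.
  exact: differentiable_pair.
have PE : (fun z => H (u * expG z)%g) = P \o (fun z => (2^-1 *: z, 2^-1 *: z)).
  by apply/funext => z; rewrite /P /= -mulgA -(exp_half hexp).
have th : 2^-1 *: (t *: xi) = h by rewrite scalerA mulrC.
rewrite /psi PE deriveE; last first.
  by apply: differentiable_comp => //; rewrite th.
rewrite diff_comp//; last by rewrite th.
rewrite /= diff_pair// th diff_val.
have -> : (2^-1 *: zeta, 2^-1 *: zeta) = 2^-1 *: ((zeta, 0) + (0, zeta)).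
  by rewrite -[(zeta, 0) + _]/(zeta + 0, 0 + zeta) addr0 add0r.
rewrite linearZ linearD /= diff_partiall// diff_partialr//= /P/= uh.
have -> : 'D_zeta (fun x => H (u * expG x * expG h)%g) h
    = 'D_zeta (fun z => H (expG ((1 - t / 2) *: xi) * expG z)%g) h.
  apply: near_eq_derive.
  have [c1 _] : gdiff (fun x => u * expG x * expG h)%g h.
    by apply: gdiff_mul; [apply: gdiff_mul => //; exact: gdiff_cst|
                          exact: gdiff_cst].
  have [c2 _] : gdiff (fun x => expG ((1 - t / 2) *: xi) * expG x)%g h.
    by apply: gdiff_mul => //; exact: gdiff_cst.
  (* Invariance is available only when both conjugate elements lie in [U], which holds near [h]
     because [U] is open. *)
  have N1 : \forall x \near h, U (u * expG x * expG h)%g.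
    by apply: c1; apply: open_nbhs_nbhs; split; rewrite // uhh.
  have N2 : \forall x \near h, U (expG ((1 - t / 2) *: xi) * expG x)%g.
    by apply: c2; apply: open_nbhs_nbhs; split; rewrite // -uh uhh.
  near=> x.
  have -> : (expG ((1 - t / 2) *: xi) * expG x)%g =
      (expG h * (u * expG x * expG h) * (expG h)^-1)%g.
    by rewrite -hu !mulgA mulgK.
  apply/esym/HAd; first by near: x.
  rewrite -!mulgA mulgV mulg1 mulgA hu; near: x; exact: N2.
by rewrite scalerDr -[_ *: _]/(_ * _) mulrC -splitr.
Unshelve. all: by end_near. Qed.

Lemma psi_half_iter k zeta : psi 1 zeta = psi (2^-1 ^+ k) zeta.
Proof.
by elim: k => [//|k ->]; rewrite psi_half exprSr.
Qed.

Variable V : set 'rV[R]_n.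
Hypothesis V0 : V 0.
Hypothesis eV : smooth_into V expG.

(** For an invariant function the noncommutative correction in the differential of the exponential
    does not contribute: [psi (2^-1 ^+ k) zeta] is constant in [k], equals the left side at [k = 0]
    and tends to the right side. *)
Lemma derive_exp_eq_left_invariant zeta :
  'D_zeta (fun x => H (expG x)) xi = left_invariant_derive phi zeta H (expG xi).
Proof.
have [Aphi phi1] := hphi.
pose e := chart_coord phi 1%g.
pose c x := chart_coord phi (expG x).
pose m (p : 'rV[R]_n * 'rV[R]_n) :=
  chart_coord phi (chart_param phi p.1 * chart_param phi p.2)%g.
pose S := [set p : 'rV[R]_n * 'rV[R]_n | [/\ chart_im phi p.1, chart_im phi p.2 &
   chart_dom phi (chart_param phi p.1 * chart_param phi p.2)%g]].
(* The limit aimed at is ['d K e zeta], the left-invariant derivative of [H] at [expG xi]. *)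
pose K x := H (expG xi * chart_param phi x)%g.
have parame : chart_param phi e = 1%g by exact: chart_coordK.
have ime : chart_im phi e by exists 1%g.
have [dm cm] : (forall p, S p -> differentiable m p) /\
    (forall p v, S p -> {for p, continuous (fun q => 'D_v m q)}).
  have [d c1] := lie_mul_smooth _ _ _ Aphi Aphi Aphi 1.
  by split=> // p v Sp; exact: c1.
have Se : S (e, e) by split=> //=; rewrite parame mulg1.
have dK : differentiable K e.
  apply: (smooth_on_differentiable Hs); last by rewrite parame mulg1.
  by apply: gdiff_mul; [exact: gdiff_cst|exact: gdiff_param].
have c0 : c 0 = e by rewrite /c (exp0 hexp).
have dom0 : chart_dom phi (expG 0) by rewrite (exp0 hexp).
have dc x : chart_dom phi (expG x) -> differentiable c x.
  by move=> dx; have [_] := gexp x; exact.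
have Dcc : {for 0, continuous (fun x => 'D_zeta c x)}.
  by have [_ /(_ phi Aphi 1)[_ c1]] := eV; apply: c1; split.
(* The velocity clause of [is_exponential] makes the differential of [expG] at [0] the identity in
   the chart [phi]. *)
have Dc0 : 'D_zeta c 0 = zeta.
  have [_ _ [_ expE]] := hexp zeta; rewrite -[RHS]expE /derive /=.
  have fE : (fun h : R => h^-1 *: (c (h *: zeta + 0) - c 0)) =
      (fun h : R => h^-1 *: (chart_coord phi (expG ((h *: (1 : R) + 0) *: zeta)) -
                 chart_coord phi (expG ((0 : R) *: zeta)))).
    by apply/funext => h; rewrite /c !addr0 scale0r -[h *: 1]/(h * 1) mulr1.
  by rewrite fE.
(* Smoothness gives continuity of the derivative of [m] in each fixed direction. Expanding [v] in
   the standard basis turns joint convergence in base point and direction into that of a finite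
   sum. *)
pose L (x y v : 'rV[R]_n) : 'rV[R]_n :=
  \sum_(i < n) v 0 i *: 'D_((0 : 'rV[R]_n), 'e_i) m (x, y).
have LE x y v : S (x, y) -> 'd m (x, y) (0, v) = L x y v.
  move=> Sxy; have dxy := dm _ Sxy.
  have -> : (0, v) = \sum_(i < n) v 0 i *: ((0 : 'rV[R]_n), ('e_i : 'rV[R]_n)).
    rewrite {1}[v]row_sum_delta; apply: (big_ind2 (fun a b => (0, a) = b)) => //.
      by move=> ? ? ? ? <- <-; rewrite -[RHS]/(_ + _, _ + _) addr0.
    by move=> i _; rewrite -[RHS]/(_ *: _, _ *: _) scaler0.
  rewrite linear_sum; apply: eq_bigr => i _.
  by rewrite linearZ /= deriveE.
have hc0 : (2^-1 ^+ k *: xi) @[k --> \oo] --> (0 : 'rV[R]_n).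
  by exact: half_iter_cvg0.
have hc0N : (- (2^-1 ^+ k *: xi)) @[k --> \oo] --> (0 : 'rV[R]_n).
  by rewrite -[X in _ --> X]oppr0; exact: cvgN.
have cc : {for 0, continuous c} by apply: differentiable_continuous; exact: dc.
have hD : 'D_zeta c (2^-1 ^+ k *: xi) @[k --> \oo] --> (zeta : 'rV[R]_n).
  rewrite -[X in _ --> X]Dc0; exact: (cvg_comp _ _ hc0 Dcc).
have hcc : (c (- (2^-1 ^+ k *: xi)), c (2^-1 ^+ k *: xi)) @[k --> \oo] -->
    ((e, e) : 'rV[R]_n * 'rV[R]_n).
  have h1 : c (- (2^-1 ^+ k *: xi)) @[k --> \oo] --> e.
    rewrite -c0; exact: (cvg_comp _ _ hc0N cc).
  have h2 : c (2^-1 ^+ k *: xi) @[k --> \oo] --> e.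
    rewrite -c0; exact: (cvg_comp _ _ hc0 cc).
  exact: cvg_pair h1 h2.
have Lcvg : (fun k => L (c (- (2^-1 ^+ k *: xi))) (c (2^-1 ^+ k *: xi))
    ('D_zeta c (2^-1 ^+ k *: xi))) @ \oo --> L e e zeta.
  apply: cvg_bigsum => i; apply: cvgZ.
    exact: (cvg_comp _ _ hD (@coord_continuous _ _ _ 0 i zeta)).
  exact: (cvg_comp _ _ hcc (cm (e, e) _ Se)).
(* Splitting [expG ((1 - t) *: xi)] as [expG xi * expG (- (t *: xi))] leaves a product close to the
   identity, which [m] computes in coordinates; only its second argument varies. *)
have psiE1 t : chart_dom phi (expG (t *: xi)) ->
    chart_dom phi (expG (- (t *: xi))) ->
    psi t zeta =
      'd K e (L (c (- (t *: xi))) (c (t *: xi)) ('D_zeta c (t *: xi))).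
  move=> dt dNt; set y0 := t *: xi.
  have uE : expG ((1 - t) *: xi) = (expG xi * expG (- y0))%g.
    by rewrite (expD_scale hexp) scale1r scaleNr.
  have m0 : m (c (- y0), c y0) = e.
    by rewrite /m /= !chart_coordK// (expN hexp).
  have S0 : S (c (- y0), c y0).
    split=> /=; [by exists (expG (- y0))|by exists (expG y0)|].
    by rewrite !chart_coordK// (expN hexp).
  have dp : differentiable (fun z => (c (- y0), c z)) y0.
    by apply: differentiable_pair; [exact: differentiable_cst|exact: dc].
  have dmp : differentiable (m \o (fun z => (c (- y0), c z))) y0.
    by apply: differentiable_comp => //; exact: dm.
  have -> : psi t zeta = 'D_zeta (K \o (m \o (fun z => (c (- y0), c z)))) y0.
    apply: near_eq_derive.
    have [gc _] : gdiff (fun z => expG (- y0) * expG z)%g y0.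
      by apply: gdiff_mul => //; exact: gdiff_cst.
    have N1 : \forall z \near y0, chart_dom phi (expG z).
      by apply: near_chart_dom => //; have [] := gexp y0.
    have N2 : \forall z \near y0, chart_dom phi (expG (- y0) * expG z)%g.
      by apply: near_chart_dom => //; rewrite (expN hexp).
    near=> z; rewrite /K /m /= !chart_coordK//; try (by near: z).
    by rewrite uE mulgA.
  have dK0 : differentiable K ((m \o (fun z => (c (- y0), c z))) y0).
    by rewrite /= m0.
  rewrite (derive_comp zeta dmp dK0) (derive_comp zeta dp (dm _ S0)).
  rewrite (derive_pair zeta (differentiable_cst _ _) (dc _ dt)) derive_cst.
  by rewrite /comp m0 LE.
(* Both [expG (2^-1 ^+ k *: xi)] and its inverse enter the domain of [phi] once [k] is large. *)
have psiE : \forall k \near \oo, 'd K e (L (c (- (2^-1 ^+ k *: xi)))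
    (c (2^-1 ^+ k *: xi)) ('D_zeta c (2^-1 ^+ k *: xi))) = psi (2^-1 ^+ k) zeta.
  have N0 : \forall z \near (0 : 'rV[R]_n), chart_dom phi (expG z).
    by apply: near_chart_dom => //; have [] := gexp 0.
  near=> k; rewrite psiE1//; near: k; [exact: (hc0 _ N0)|exact: (hc0N _ N0)].
(* Near [e], the map sending [y] to [m (e, y)] is the identity, as [chart_param phi e] is the
   unit. *)
have Le : L e e zeta = zeta.
  rewrite -LE// diff_partialr//; last exact: dm.
  rewrite -[RHS](derive_id e zeta); apply: near_eq_derive.
  have Nim : \forall y \near e, chart_im phi y.
    by apply: open_nbhs_nbhs; split => //; have [] := lie_atlas_chart _ Aphi.
  near=> y; rewrite /m /= parame mul1g.
  have [g dg <-] : chart_im phi y by near: y.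
  by rewrite chart_coordK.
have lim1 : psi (2^-1 ^+ k) zeta @[k --> \oo] --> 'd K e zeta.
  rewrite -[in 'd K e zeta]Le.
  apply: cvg_trans (near_eq_cvg psiE) _.
  apply: (cvg_comp _ _ Lcvg); exact: diff_continuous.
have -> : 'D_zeta (fun x => H (expG x)) xi = psi 1 zeta.
  rewrite /psi subrr scale0r (exp0 hexp) scale1r.
  by congr ('D_zeta _ xi); apply/funext => z; rewrite mul1g.
rewrite /left_invariant_derive deriveE//.
apply/esym/(cvg_unique _ lim1) => //.
rewrite (_ : (fun k => _) = cst (psi 1 zeta)); first exact: cvg_cst.
by apply/funext => k; rewrite -psi_half_iter.
Unshelve. all: by end_near. Qed.

End radial_derivative.

(** * The derivative of half a quadratic form *)

(** Linearity is asked only for a first argument in [V], because for the Killing form it will be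
    deduced from the gradient equation on [V]. Symmetry transfers it to the first argument. *)
Lemma is_derive_half_square (R : realType) (E : normedModType R)
    (B : E -> E -> R) (V : set E) :
  open V -> V 0 -> (forall x y, B x y = B y x) ->
  (forall x a u v, V x -> B x (a *: u + v) = a * B x u + B x v) ->
  forall x v, V x -> is_derive x v (fun y => 2^-1 * B y y) (B x v).
Proof.
move=> Vo V0 Bsym Blin x v Vx.
have BZ z a u : V z -> B z (a *: u) = a * B z u.
  move=> Vz; rewrite -[a *: u]addr0 Blin//.
  have := Blin z 1 0 0 Vz; rewrite scaler0 addr0 mul1r -[LHS]addr0.
  by move/addrI <-; rewrite addr0.
have [r r0 Vr] : exists2 r : R, r != 0 & V (r *: v).
  have [k _ /(_ k (leqnn k)) Vk] : \forall k \near \oo, V ((2^-1 ^+ k) *: v).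
    by apply: (half_iter_cvg0 v); apply: open_nbhs_nbhs; split.
  by exists (2^-1 ^+ k); rewrite // expf_neq0// invr_neq0// pnatr_eq0.
(* [B w v] is affine in [w] only after moving [v] into [V] and swapping. *)
pose s := 2^-1 * (r^-1 * B (r *: v) v).
(* An exact expansion to second order, in which [s] stands for [2^-1 * B v v], since [v] itself may
   lie outside [V]. *)
have expand h : V (h *: v + x) ->
    2^-1 * B (h *: v + x) (h *: v + x) = 2^-1 * B x x + h * (B x v + h * s).
  move wE: (h *: v + x) => w Vw.
  have Bwx : B w x = h * B x v + B x x by rewrite Bsym -wE Blin.
  have Bwv : B w v = B x v + h * (r^-1 * B (r *: v) v).
    have : r * B w v = r * B x v + h * B (r *: v) v.
      rewrite -(BZ w)// (Bsym w) -wE Blin// (Bsym (r *: v) x) BZ//.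
      exact: addrC.
    move/(congr1 ( *%R r^-1)); rewrite mulrDr !mulKf// => ->.
    by rewrite mulrCA.
  have -> : B w w = h * B w v + B w x by rewrite -{2}wE Blin.
  rewrite Bwx Bwv /s.
  by field.
have quot : (fun h => h^-1 *: (2^-1 * B (h *: v + x) (h *: v + x)
    - 2^-1 * B x x)) @ 0^' --> B x v.
  have lim : (fun h => B x v + h * s) @ (0 : R)^' --> B x v.
    rewrite -[X in _ --> X]addr0 -[X in _ --> _ + X](mul0r s).
    apply: cvg_within_filter; apply: cvgD; first exact: cvg_cst.
    by apply: cvgM; [exact: cvg_id|exact: cvg_cst].
  apply: cvg_trans lim; apply: near_eq_cvg.
  have Vh : \forall h \near (0 : R)^', V (h *: v + x).
    apply: cvg_within.
    have hc : (h *: v + x) @[h --> (0 : R)] --> x.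
      rewrite -[X in _ --> X]add0r -(scale0r v); apply: cvgD => //.
        exact: scalel_continuous.
      exact: cvg_cst.
    by apply: hc; apply: open_nbhs_nbhs; split.
  near=> h; rewrite expand//; last by near: h.
  rewrite [2^-1 * _ + _]addrC addrK -[RHS]/(_ * (_ * _)) mulKf//.
  by near: h; exact: nbhs_dnbhs_neq.
by split; [exact: cvgP quot|exact: cvg_lim quot].
Unshelve. all: by end_near. Qed.

Theorem proposition14 (R : realType) (n : nat) (G : lieGroupType R n)
    (phi : chart R n G) (hphi : chart_at_identity phi)
    (hsimple : simple_lie_group phi)
    (hreal : real_form_of_complex_simple phi)
    (expG : 'rV[R]_n -> G) (hexp : is_exponential phi expG)
    (V : set 'rV[R]_n) (V_open : open V) (V_connected : connected V)
    (V_0 : V 0) (hdiffeo : diffeo_onto_open_image V expG)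
    (H : G -> R) (H_smooth : smooth_on (expG @` V) H)
    (H_inv : Ad_invariant_on (expG @` V) H)
    (gradH : G -> 'rV[R]_n) (hgrad : is_gradient_on phi (expG @` V) H gradH)
    (hsol : forall xi, V xi -> xi = gradH (expG xi)) :
  exists c : R, forall xi, V xi -> H (expG xi) = 2^-1 * killing phi xi xi + c.
Proof.
have [Uo eV _] := hdiffeo.
have [Aphi phi1] := hphi.
have gexp := gdiff_exp hexp V_open V_0 eV.
have Uexp x : V x -> (expG @` V) (expG x) by move=> Vx; exists x.
(* The equation [x = gradH (expG x)] eliminates the gradient. *)
have killingE x eta : V x ->
    killing phi x eta = left_invariant_derive phi eta H (expG x).
  by move=> Vx; rewrite {1}(hsol x Vx) hgrad//; exact: Uexp.
have killingC x y : killing phi x y = killing phi y x.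
  exact: mxtrace_mulC.
(* Linearity is read off from the right side of [killingE], a differential applied to the
   direction. *)
have killing_lin x a u v : V x ->
    killing phi x (a *: u + v) = a * killing phi x u + killing phi x v.
  move=> Vx; have dH : differentiable
      (fun y => H (expG x * chart_param phi y)%g) (chart_coord phi 1%g).
    apply: (smooth_on_differentiable H_smooth).
      by apply: gdiff_mul; [exact: gdiff_cst|apply: gdiff_param => //; exists 1%g].
    by rewrite chart_coordK// mulg1; exact: Uexp.
  by rewrite !killingE// /left_invariant_derive !deriveE// linearP.
have dF x v : V x -> is_derive x v (fun y => H (expG y)) (killing phi x v).
  move=> Vx; rewrite killingE//.
  rewrite -(derive_exp_eq_left_invariant hphi hexp gexp Uo H_smooth H_inv
    (Uexp x Vx) V_0 eV v).
  apply/derivableP/diff_derivable.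
  by apply: (smooth_on_differentiable H_smooth) => //; exact: Uexp.
have dQ := is_derive_half_square V_open V_0 killingC killing_lin.
(* The constant is the value at [0] of a difference whose derivatives vanish on the connected set
   [V]. *)
exists (H (expG 0) - 2^-1 * killing phi 0 0) => x Vx.
apply/eqP; rewrite addrC -subr_eq; apply/eqP.
apply: (derive_zero_constant (f := fun y => H (expG y) - 2^-1 * killing phi y y)
  V_open V_connected _ V_0 Vx) => y v Vy.
rewrite -[X in is_derive _ _ _ X](subrr (killing phi y v)).
by apply: is_deriveB; [exact: dF|exact: dQ].
Qed.
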